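(* Suppose that $g$ is an asymptotically flat axisymmetric metric and let $\rho$ be the cylindrical radial coordinate of $g$, i.e. the solution of $$\Delta_g\omega-\frac{1}{2|\eta|_g^2}\langle\nabla\omega,\nabla|\eta|_g^2\rangle_g=0$$ (with $\omega=\rho$). The metric $g$ is radially monotone if and only if the level sets of $\rho$ form a family of surfaces evolving by a sub-inverse-mean-curvature flow.
   Context: An axisymmetric metric is a smooth Riemannian metric $g$ given in global cylindrical coordinates $(\rho,z,\phi)$ by $g=e^{2\alpha-2u}(d\rho^2+dz^2)+\rho^2e^{-2u}(d\phi+B\,d\rho+A\,dz)^2$, where $\alpha,u,A,B$ depend only on $(\rho,z)$; its Killing field is $\eta=\partial/\partial\phi$. The displayed equation says that $\rho$ is harmonic for the orbit metric $q$ on $M/S^1$; the coordinate function $\rho$ is the solution of this equation that vanishes on the axis and preserves asymptotic flatness, and it is uniquely determined by these requirements. Radially monotone: $\frac{\partial}{\partial\rho}\Big(\frac1\rho\frac{|\eta|_g}{|\nabla\rho|_g}\Big)\le0$ for all $\rho>0$ and all $z$; equivalently $\partial_\rho(\alpha-2u)\le 0$. The level sets of $\rho$ form a sub-inverse-mean-curvature flow if their mean curvature $H=\mathrm{div}_g(\nabla\rho/|\nabla\rho|_g)$ (with respect to the unit normal $\nabla\rho/|\nabla\rho|_g$) satisfies $H\le|\nabla\log\rho|_g$ on $\{\rho>0\}$. *)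

(* Defs.v *)
From HB Require Import structures.
From mathcomp Require Import all_boot all_order all_algebra.
From mathcomp Require Import all_classical all_reals all_analysis.

Set Implicit Arguments.
Unset Strict Implicit.
Unset Printing Implicit Defensive.

Import Order.TTheory GRing.Theory Num.Theory.
Import numFieldNormedType.Exports.

Local Open Scope classical_set_scope.
Local Open Scope ring_scope.

Section Calculus.
Context {R : realType} {n : nat}.
Implicit Types (f : 'rV[R]_n.+1 -> R) (p v w : 'rV[R]_n.+1).

Definition partial (i : 'I_n.+1) f p : R := 'D_(delta_mx 0 i) f p.

(* [iter_partial [:: i_1; ...; i_k] f] is d_(i_1) ... d_(i_k) f. *)
Definition iter_partial (s : seq 'I_n.+1) f : 'rV[R]_n.+1 -> R :=
  foldr partial f s.

(* C^infinity on the open set D: iterated partials of every order are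
   (Frechet) differentiable, hence also continuous, at every point of D. *)
Definition smooth_on (D : set 'rV[R]_n.+1) f : Prop :=
  forall (s : seq 'I_n.+1) p, D p -> differentiable (iter_partial s f) p.

(* The norm of the library on 'rV is the sup norm. *)
Definition enorm p : R := Num.sqrt (\sum_i p 0 i ^+ 2).

End Calculus.

(* Riemannian operators in a coordinate chart.  A metric is its matrix-valued
   function of components g_ij; tangent vectors are row vectors. *)
Section Riemann.
Context {R : realType} {n : nat}.
Implicit Types (g : 'rV[R]_n.+1 -> 'M[R]_n.+1) (f : 'rV[R]_n.+1 -> R).
Implicit Types (X : 'rV[R]_n.+1 -> 'rV[R]_n.+1) (p v w : 'rV[R]_n.+1).

Definition inner g p v w : R := (v *m g p *m w^T) 0 0.

Definition gnorm g p v : R := Num.sqrt (inner g p v v).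

Definition grad g f p : 'rV[R]_n.+1 :=
  (\row_i partial i f p) *m invmx (g p).

Definition divergence g X p : R :=
  (Num.sqrt (\det (g p)))^-1 *
  \sum_i partial i (fun q => Num.sqrt (\det (g q)) * X q 0 i) p.

Definition laplacian g f p : R := divergence g (grad g f) p.

Definition unit_normal g f p : 'rV[R]_n.+1 :=
  (gnorm g p (grad g f p))^-1 *: grad g f p.

(* Mean curvature of the level set of f through p. *)
Definition mean_curvature g f p : R := divergence g (unit_normal g f) p.

Definition riemannian_metric g : Prop :=
  [/\ forall i j, smooth_on setT (fun p => g p i j),
      forall p, (g p)^T = g p
    & forall p v, v != 0 -> 0 < inner g p v v].

(* Components of the metric (F^* g), by rows: v *m 'J F p = 'd F p v. *)
Definition pullback (F : 'rV[R]_n.+1 -> 'rV[R]_n.+1) g p : 'M[R]_n.+1 :=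
  'J F p *m g (F p) *m ('J F p)^T.

(* g_ij - delta_ij = o_2(r^{-1/2}): k-th order partials of g_ij - delta_ij are
   o(r^{-1/2-k}) for k <= 2.  This is implied by the O_2(r^{-tau}) decay with
   tau > 1/2. *)
Definition asymptotically_flat g : Prop :=
  forall (i j : 'I_n.+1) (s : seq 'I_n.+1), (size s <= 2)%N ->
  forall e : R, 0 < e -> exists r0 : R, forall x, r0 < enorm x ->
    `|iter_partial s (fun y => g y i j - (i == j)%:R) x|
      <= e * enorm x `^ (- (2^-1 + (size s)%:R)).

End Riemann.

Section Axisymmetric.
Context {R : realType}.
Implicit Types (p : 'rV[R]_3) (alpha u A B : R -> R -> R).
Implicit Types (g : 'rV[R]_3 -> 'M[R]_3) (f : 'rV[R]_3 -> R).

(* A point of the cylindrical chart is the row vector (rho, z, phi). *)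
Definition irho : 'I_3 := 0.
Definition iz : 'I_3 := 1.
Definition iphi : 'I_3 := ord_max.

Definition rho p : R := p 0 irho.
Definition zed p : R := p 0 iz.
Definition phi p : R := p 0 iphi.

Definition cartesian p : 'rV[R]_3 :=
  \row_(i < 3) [:: rho p * cos (phi p); rho p * sin (phi p); zed p]`_i.

(* e^{2 alpha - 2 u} (drho^2 + dz^2)
   + rho^2 e^{-2 u} (dphi + B drho + A dz)^2 *)
Definition cyl_metric alpha u A B p : 'M[R]_3 :=
  let a := alpha (rho p) (zed p) in
  let v := u (rho p) (zed p) in
  let theta : 'rV[R]_3 :=
    \row_(i < 3) [:: B (rho p) (zed p); A (rho p) (zed p); 1]`_i in
  expR (2 * a - 2 * v) *: (delta_mx irho irho + delta_mx iz iz)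
  + (rho p ^+ 2 * expR (- 2 * v)) *: (theta^T *m theta).

Definition smooth_half_plane (h : R -> R -> R) : Prop :=
  smooth_on [set q : 'rV[R]_2 | 0 < q 0 0] (fun q => h (q 0 0) (q 0 1)).

(* g is given on all of R^3 in Cartesian components, so that its smoothness
   across the axis {rho = 0}, where the cylindrical chart degenerates, is
   part of the hypothesis. *)
Definition axisymmetric_metric g alpha u A B : Prop :=
  [/\ riemannian_metric g,
      [/\ smooth_half_plane alpha, smooth_half_plane u,
          smooth_half_plane A & smooth_half_plane B]
    & forall p, 0 < rho p ->
        pullback cartesian g p = cyl_metric alpha u A B p].

(* The Killing field d/dphi in the cylindrical chart. *)
Definition eta : 'rV[R]_3 := delta_mx 0 iphi.

(* In the following definitions g is the matrix of the metric in the
   cylindrical chart. *)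

Definition radial_equation g (omega : 'rV[R]_3 -> R) : Prop :=
  forall p, 0 < rho p ->
    laplacian g omega p
    - (2 * gnorm g p eta ^+ 2)^-1 *
      inner g p (grad g omega p) (grad g (fun q => gnorm g q eta ^+ 2) p)
    = 0.

Definition radially_monotone g : Prop :=
  forall p, 0 < rho p ->
    partial irho
      (fun q => (rho q)^-1 * (gnorm g q eta / gnorm g q (grad g rho q))) p
    <= 0.

Definition sub_imcf g f : Prop :=
  forall p, 0 < f p ->
    mean_curvature g f p <= gnorm g p (grad g (fun q => ln (f q)) p).

End Axisymmetric.

(* Main.v *)
(** Writing the metric in the orthogonal coframe drho, dz,
    dphi + B drho + A dz gives volume density rho e^(2 alpha - 3 u), and
    grad rho = e^(2 u - 2 alpha) (d_rho - B d_phi).  Hence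
    H = e^(u - alpha) (1 / rho + d_rho (alpha - 2 u)) and
    |grad log rho| = e^(u - alpha) / rho, while
    |eta| / (rho |grad rho|) = e^(alpha - 2 u); so both conditions are
    d_rho (alpha - 2 u) <= 0. *)
Require Import Defs.
From mathcomp Require Import all_boot all_order all_algebra.
From mathcomp Require Import all_classical all_reals all_analysis.
From mathcomp Require Import ring.

Import Order.TTheory GRing.Theory Num.Theory.
Import numFieldNormedType.Exports.
(* [gnorm] is also a multirule of MathComp's monoid library. *)
Import Defs.

Local Open Scope ring_scope.

(** * Partial derivatives of functions on the half-space [rho > 0] *)

Section Calculus.
Context {R : realType}.
Implicit Types (n : nat).

(** Equating the quotients themselves transfers both the value of the derivative and derivability,
    with no regularity assumed of [f]. *)
Lemma difference_quotient_section n (f : 'rV[R]_n.+1 -> R) (k : R -> R)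
    (p v : 'rV[R]_n.+1) (t : R) :
  (forall h, f (h *: v + p) = k (h + t)) ->
  (fun h : R => h^-1 *: ((f \o shift p) (h *: v) - f p)) =
  (fun h : R => h^-1 *: ((k \o shift t) (h *: (1 : R)) - k t)).
Proof.
move=> fk; have fp : f p = k t by rewrite -[t]add0r -fk scale0r add0r.
by apply/funext => h /=; rewrite fk fp /GRing.scale /= mulr1.
Qed.

Lemma derive_section n (f : 'rV[R]_n.+1 -> R) (k : R -> R)
    (p v : 'rV[R]_n.+1) (t : R) :
  (forall h, f (h *: v + p) = k (h + t)) -> 'D_v f p = 'D_1 k t.
Proof. by move=> fk; rewrite /derive (difference_quotient_section _ _ _ _ _ _ fk). Qed.

Lemma derivable_section n (f : 'rV[R]_n.+1 -> R) (k : R -> R)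
    (p v : 'rV[R]_n.+1) (t : R) :
  (forall h, f (h *: v + p) = k (h + t)) ->
  derivable f p v -> derivable k t 1.
Proof. by move=> fk; rewrite /derivable (difference_quotient_section _ _ _ _ _ _ fk). Qed.

Lemma derive_constant_along n (f : 'rV[R]_n.+1 -> R) (p v : 'rV[R]_n.+1) :
  (forall h, f (h *: v + p) = f p) -> 'D_v f p = 0.
Proof.
by move=> fv; rewrite (derive_section _ _ (cst (f p)) _ _ 0)// derive_val.
Qed.

(** The half-space [rho > 0] is open. The closed formulas below for densities and norms are only
    proved there, so this lets them be used under a derivative. *)
Lemma partial_eq_near_rho (i : 'I_3) (f h : 'rV[R]_3 -> R) (p : 'rV[R]_3) :
  0 < rho p -> (forall q, 0 < rho q -> f q = h q) ->
  partial i f p = partial i h p.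
Proof.
move=> p0 fh; apply: near_eq_derive.
have rho_cont : {for p, continuous (fun q : 'rV[R]_3 => q 0 irho)}.
  exact: coord_continuous.
have rho_gt0 := @cvgr_gt _ _ _ (nbhs_filter p) _ _ rho_cont _ p0.
by apply: filterS rho_gt0 => q; exact: fh.
Qed.

Lemma partial_rhoE (F : R -> R -> R) (p : 'rV[R]_3) :
  partial irho (fun q => F (rho q) (zed q)) p = 'D_1 (F ^~ (zed p)) (rho p).
Proof.
apply: derive_section => h.
by rewrite /rho /zed !mxE !eqxx mulr1 mulr0 add0r.
Qed.

Lemma partial_phiE (F : R -> R -> R) (p : 'rV[R]_3) :
  partial iphi (fun q => F (rho q) (zed q)) p = 0.
Proof.
apply: derive_constant_along => h; congr (F _ _);
  by rewrite /rho /zed !mxE mulr0 add0r.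
Qed.

Lemma derivable_half_plane (h : R -> R -> R) (r z : R) :
  smooth_half_plane h -> 0 < r -> derivable (h ^~ z) r 1.
Proof.
move=> hS r0; pose p : 'rV[R]_2 := \row_(i < 2) [:: r; z]`_i.
have p0 : 0 < p 0 0 by rewrite mxE.
have dh : derivable (fun q : 'rV[R]_2 => h (q 0 0) (q 0 1)) p (delta_mx 0 0).
  exact: diff_derivable (hS [::] p p0).
apply: derivable_section dh => t.
by rewrite !mxE /= mulr1 mulr0 add0r.
Qed.

Lemma derivable_expR_comp (k : R -> R) (t : R) :
  derivable k t 1 -> derivable (fun s => expR (k s)) t 1.
Proof.
move=> /derivableP kd.
exact: (@ex_derive _ _ _ _ _ _ _ (is_derive1_comp (is_derive_expR _) kd)).
Qed.

Lemma sum_I3 (F : 'I_3 -> R) : \sum_i F i = F irho + F iz + F iphi.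
Proof.
rewrite !big_ord_recl big_ord0 addr0 addrA.
by congr (F _ + F _ + F _); apply: val_inj.
Qed.

Lemma ord3_ind (P : 'I_3 -> Prop) : P irho -> P iz -> P iphi -> forall i, P i.
Proof.
move=> P0 P1 P2 [[|[|[|//]]] Hi].
- by have <- : irho = Ordinal Hi by apply: val_inj.
- by have <- : iz = Ordinal Hi by apply: val_inj.
- by have <- : iphi = Ordinal Hi by apply: val_inj.
Qed.

End Calculus.

(** * Gradients and norms for a general metric *)

Section Riemann.
Context {R : realType} {n : nat}.
Implicit Types (g : 'rV[R]_n.+1 -> 'M[R]_n.+1) (f h : 'rV[R]_n.+1 -> R).

(** Lets a gradient be guessed and checked, so that the inverse matrix is never computed. *)
Lemma grad_unique g f p (X : 'rV[R]_n.+1) : g p \in unitmx ->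
  X *m g p = \row_i partial i f p -> grad g f p = X.
Proof. by move=> gU gX; rewrite /grad -gX mulmxK. Qed.

Lemma inner_gradr g f (p v : 'rV[R]_n.+1) : g p \in unitmx -> (g p)^T = g p ->
  inner g p v (grad g f p) = \sum_i v 0 i * partial i f p.
Proof.
move=> gU gT; rewrite /inner /grad trmx_mul trmx_inv gT mulmxA mulmxK// mxE.
by apply: eq_bigr => i _; rewrite !mxE.
Qed.

Lemma gnormZ g (p v : 'rV[R]_n.+1) (c : R) : 0 <= c ->
  gnorm g p (c *: v) = c * gnorm g p v.
Proof.
move=> c0; rewrite /gnorm /inner linearZ /= -!scalemxAl -scalemxAr !mxE mulrA.
by rewrite -expr2 sqrtrM ?sqr_ge0// sqrtr_sqr ger0_norm.
Qed.

End Riemann.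

(** * The metric in cylindrical coordinates *)

Section CylindricalMetric.
Context {R : realType}.
Variables alpha u A B : R -> R -> R.
Let gc := cyl_metric alpha u A B.
Implicit Types (p q : 'rV[R]_3).

Let x p := expR (alpha (rho p) (zed p)).
Let y p := expR (u (rho p) (zed p)).
Let b p := B (rho p) (zed p).
Let c p := A (rho p) (zed p).

Let x_neq0 p : x p != 0. Proof. by rewrite gt_eqF ?expR_gt0. Qed.
Let y_neq0 p : y p != 0. Proof. by rewrite gt_eqF ?expR_gt0. Qed.
Let xy_gt0 p : 0 < x p / y p. Proof. by rewrite divr_gt0 ?expR_gt0. Qed.

Lemma expR2 (t : R) : expR (2 * t) = expR t ^+ 2.
Proof. by rewrite mulrC expRM_natr. Qed.

Let conformal p :
  expR (2 * alpha (rho p) (zed p) - 2 * u (rho p) (zed p)) = (x p / y p) ^+ 2.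
Proof. by rewrite -mulrBr expR2 expRB. Qed.

Let orbit p : rho p ^+ 2 * expR (- 2 * u (rho p) (zed p)) = (rho p / y p) ^+ 2.
Proof. by rewrite mulNr -mulrN expR2 expRN -exprMn. Qed.

(* The coframe (drho, dz, dphi + B drho + A dz), orthogonal for gc. *)
Let coframe p : 'M[R]_3 :=
  \matrix_(i < 3, j < 3)
    (nth [::] [:: [:: 1; 0; 0]; [:: 0; 1; 0]; [:: b p; c p; 1]] i)`_j.

Let scale p : 'rV[R]_3 :=
  \row_(i < 3) [:: (x p / y p) ^+ 2; (x p / y p) ^+ 2; (rho p / y p) ^+ 2]`_i.

Let cyl_metric_frame p :
  gc p = (coframe p)^T *m diag_mx (scale p) *m coframe p.
Proof.
rewrite /gc /cyl_metric conformal orbit mul_mx_diag.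
apply/matrixP; elim/ord3_ind; elim/ord3_ind;
  rewrite !mxE !sum_I3 big_ord1 !mxE /= /b /c; ring.
Qed.

Lemma cyl_metric_sym p : (gc p)^T = gc p.
Proof. by rewrite cyl_metric_frame !trmx_mul trmxK tr_diag_mx mulmxA. Qed.

(** The coframe matrix is lower triangular with unit diagonal, so only the entries of [scale]
    contribute. *)
Lemma det_cyl_metric p : \det (gc p) = ((x p / y p) ^+ 2 * (rho p / y p)) ^+ 2.
Proof.
rewrite cyl_metric_frame !det_mulmx det_tr det_diag.
rewrite det_trig; last first.
  by apply/is_trig_mxP; elim/ord3_ind; elim/ord3_ind; rewrite // !mxE.
rewrite !big_ord_recl !big_ord0 !mxE /=; ring.
Qed.

Lemma cyl_metric_unit p : 0 < rho p -> gc p \in unitmx.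
Proof.
move=> p0; rewrite unitmxE det_cyl_metric unitfE sqrf_eq0.
rewrite gt_eqF//; apply: mulr_gt0; first exact: exprn_gt0.
by rewrite divr_gt0 ?expR_gt0.
Qed.

Lemma sqrt_det_cyl_metric p : 0 < rho p ->
  Num.sqrt (\det (gc p)) = (x p / y p) ^+ 2 * (rho p / y p).
Proof.
move=> p0; rewrite det_cyl_metric sqrtr_sqr ger0_norm// mulr_ge0 ?sqr_ge0//.
by rewrite divr_ge0 ?expR_ge0// ltW.
Qed.

(** The square is free of any sign condition on [rho], so this rewrites as an equality of
    functions. *)
Lemma gnorm_eta_sqr p : gnorm gc p eta ^+ 2 = (rho p / y p) ^+ 2.
Proof.
have -> : gnorm gc p eta = Num.sqrt ((rho p / y p) ^+ 2).
  congr Num.sqrt; rewrite /inner /eta -rowE trmx_delta -colE !mxE.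
  by rewrite big_ord1 !mxE /= conformal orbit; ring.
by rewrite sqr_sqrtr ?sqr_ge0.
Qed.

Lemma gnorm_eta p : 0 < rho p -> gnorm gc p eta = rho p / y p.
Proof.
move=> p0; have r0 : 0 <= rho p / y p by rewrite divr_ge0 ?expR_ge0// ltW.
by apply/eqP; rewrite -(@eqrXn2 _ 2)// ?gnorm_eta_sqr// sqrtr_ge0.
Qed.

(** The field d_rho - B d_phi, which is annihilated by dz and by dphi + B drho + A dz. Hence
    lowering its index leaves a multiple of drho. *)
Let radial_vec p : 'rV[R]_3 := \row_(i < 3) [:: 1; 0; - b p]`_i.

Lemma radial_vec_metric p :
  radial_vec p *m gc p = (x p / y p) ^+ 2 *: delta_mx 0 irho.
Proof.
rewrite /gc /cyl_metric conformal orbit.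
apply/matrixP => i; rewrite (ord1 i); elim/ord3_ind;
  rewrite !mxE !sum_I3 !mxE !big_ord1 !mxE /= /b; ring.
Qed.

(** Stated for a function of [rho] so as to cover both [rho] and [ln rho]. *)
Lemma grad_radial (k : R -> R) p (k' : R) : 0 < rho p ->
  is_derive (rho p) 1 k k' ->
  grad gc (fun q => k (rho q)) p = (k' * (y p / x p) ^+ 2) *: radial_vec p.
Proof.
move=> p0 kd; apply: grad_unique; first exact: cyl_metric_unit.
rewrite -scalemxAl radial_vec_metric scalerA -mulrA -exprMn.
rewrite -[y p / x p]invf_div mulVf ?mulf_neq0 ?invr_neq0//.
apply/matrixP => i j; rewrite (ord1 i); elim/ord3_ind: j; rewrite !mxE /=.
- by rewrite (partial_rhoE (fun r _ => k r)) derive_val expr1n !mulr1.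
- rewrite mulr0 [RHS]derive_constant_along// => h.
  by rewrite /rho !mxE mulr0 add0r.
- by rewrite mulr0 (partial_phiE (fun r _ => k r)).
Qed.

Lemma grad_rho p : 0 < rho p -> grad gc rho p = (y p / x p) ^+ 2 *: radial_vec p.
Proof. by move=> p0; rewrite (grad_radial id p 1)// mul1r. Qed.

Lemma gnorm_radial_vec p : gnorm gc p (radial_vec p) = x p / y p.
Proof.
rewrite /gnorm /inner radial_vec_metric -scalemxAl -rowE !mxE /= mulr1.
by rewrite sqrtr_sqr ger0_norm// ltW.
Qed.

Lemma gnorm_grad_rho p : 0 < rho p -> gnorm gc p (grad gc rho p) = y p / x p.
Proof.
move=> p0; rewrite grad_rho// gnormZ ?sqr_ge0// gnorm_radial_vec.
by field; rewrite x_neq0 y_neq0.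
Qed.

Lemma gnorm_grad_ln_rho p : 0 < rho p ->
  gnorm gc p (grad gc (fun q => ln (rho q)) p) = (rho p)^-1 * (y p / x p).
Proof.
move=> p0; have ln' := is_derive1_ln p0; rewrite (grad_radial _ p _ p0 ln').
rewrite gnormZ; last by rewrite mulr_ge0 ?sqr_ge0// invr_ge0 ltW.
by rewrite gnorm_radial_vec; field; rewrite x_neq0 y_neq0 gt_eqF.
Qed.

(* Only the rho-component contributes: the phi-component does not depend on
   phi. *)
Lemma divergence_radial (X : 'rV[R]_3 -> 'rV[R]_3) (F k : R -> R -> R) p :
  0 < rho p ->
  (forall q, 0 < rho q -> X q = F (rho q) (zed q) *: radial_vec q) ->
  (forall r z, expR (alpha r z) ^+ 2 / expR (u r z) ^+ 3 * r * F r z = k r z) ->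
  divergence gc X p =
    ((x p / y p) ^+ 2 * (rho p / y p))^-1 * 'D_1 (k ^~ (zed p)) (rho p).
Proof.
move=> p0 XE kE; rewrite /divergence sqrt_det_cyl_metric//; congr (_ * _).
(* [k] is the volume density times [F], supplied by the caller in simplified form. *)
have volE (i : 'I_3) q : 0 < rho q -> Num.sqrt (\det (gc q)) * X q 0 i =
    k (rho q) (zed q) * radial_vec q 0 i.
  move=> q0; rewrite sqrt_det_cyl_metric// XE// mxE -kE -/(x q) -/(y q).
  by field; rewrite y_neq0.
rewrite sum_I3 !(partial_eq_near_rho _ _ _ _ p0 (volE _)).
(* The z-entry of [radial_vec] is zero. *)
rewrite [X in _ + X + _]derive_constant_along ?addr0; last first.
  by move=> h; rewrite !mxE !mulr0.
rewrite -partial_rhoE -[RHS]addr0; congr (_ + _).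
  by congr (partial _ _ p); apply/funext => q; rewrite mxE mulr1.
rewrite -[RHS](partial_phiE (fun r z => k r z * - B r z) p).
by congr (partial _ _ p); apply/funext => q; rewrite mxE.
Qed.

(** With m = |eta| the volume density is e^(2 alpha - 2 u) m, so density times grad rho has
    rho-component m. Both terms of the equation are then e^(2 u - 2 alpha) m' / m, where m' is the
    rho-derivative of m. *)
Lemma radial_equation_rho : smooth_half_plane u -> radial_equation gc rho.
Proof.
move=> uS p p0; pose m r z := r / expR (u r z).
pose m' := 'D_1 (m ^~ (zed p)) (rho p).
have md : derivable (m ^~ (zed p)) (rho p) 1.
  apply: derivableM; first exact: derivable_id.
  apply: derivableV; first by rewrite gt_eqF ?expR_gt0.
  exact/derivable_expR_comp/derivable_half_plane.
have etaE (i : 'I_3) : partial i (fun q => gnorm gc q eta ^+ 2) p =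
    partial i (fun q => m (rho q) (zed q) ^+ 2) p.
  by congr (partial _ _ p); apply/funext => q; rewrite gnorm_eta_sqr.
(* The z-partial of |eta|^2 stays uncomputed, since the zero z-entry of grad rho multiplies it. *)
rewrite inner_gradr ?cyl_metric_unit ?cyl_metric_sym// sum_I3 !etaE.
rewrite (partial_rhoE (fun r z => m r z ^+ 2)).
rewrite (partial_phiE (fun r z => m r z ^+ 2)).
have -> : 'D_1 (fun r => m r (zed p) ^+ 2) (rho p) = 2 * m (rho p) (zed p) * m'.
  under eq_fun do rewrite expr2.
  rewrite deriveM//= /GRing.scale /= -/m'; ring.
rewrite grad_rho// !mxE /= gnorm_eta_sqr.
rewrite /laplacian (divergence_radial _
  (fun r z => expR (u r z) ^+ 2 / expR (alpha r z) ^+ 2) m _ p0).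
- rewrite -/m' /m -/(y p); field.
  by rewrite x_neq0 y_neq0 gt_eqF.
- by move=> q q0; rewrite grad_rho// expr_div_n.
- by move=> r z; rewrite /m; field; rewrite !gt_eqF ?expR_gt0.
Qed.

(* Both inequalities say that d_rho exp (alpha - 2 u) <= 0. *)
Lemma radially_monotone_sub_imcf :
  smooth_half_plane alpha -> smooth_half_plane u ->
  radially_monotone gc <-> sub_imcf gc rho.
Proof.
move=> alphaS uS; pose f r z := expR (alpha r z) / expR (u r z) ^+ 2.
(* The two inequalities are equivalent at each point, which gives both implications at once. *)
suff fE p : 0 < rho p ->
    (partial irho (fun q => (rho q)^-1 *
       (gnorm gc q eta / gnorm gc q (grad gc rho q))) p <= 0) =
    (mean_curvature gc rho p <= gnorm gc p (grad gc (fun q => ln (rho q)) p)).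
  by split=> H p p0; move: (H p p0); rewrite fE.
move=> p0; pose f' := 'D_1 (f ^~ (zed p)) (rho p).
have fd : derivable (f ^~ (zed p)) (rho p) 1.
  apply: derivableM; first exact/derivable_expR_comp/derivable_half_plane.
  apply: derivableV; first by rewrite gt_eqF ?exprn_gt0 ?expR_gt0.
  have ud := derivable_expR_comp _ _ (derivable_half_plane _ _ (zed p) uS p0).
  by under eq_fun do rewrite expr2; exact: derivableM.
rewrite (partial_eq_near_rho _ _ (fun q => f (rho q) (zed q)) _ p0); last first.
  move=> q q0; rewrite gnorm_eta// gnorm_grad_rho// /f -/(x q) -/(y q).
  have := gt_eqF q0; move: (x_neq0 q) (y_neq0 q).
  by move: (x q) (y q) (rho q) => X Y r X0 Y0 r0; field; rewrite X0 Y0 r0.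
rewrite partial_rhoE -/f' gnorm_grad_ln_rho// /mean_curvature.
(* The unit normal is e^(u - alpha) times [radial_vec]; multiplied by the density rho e^(2 alpha - 3
   u), this coefficient becomes rho e^(alpha - 2 u), that is, [r * f r z]. *)
rewrite (divergence_radial _ (fun r z => expR (u r z) / expR (alpha r z))
  (fun r z => r * f r z) _ p0); first last.
- by move=> r z; rewrite /f; field; rewrite !gt_eqF ?expR_gt0.
- move=> q q0; rewrite /unit_normal gnorm_grad_rho// grad_rho// scalerA.
  by congr (_ *: _); rewrite -/(x q) -/(y q); field; rewrite x_neq0 y_neq0.
have -> : 'D_1 (fun r : R => r * f r (zed p)) (rho p) =
    rho p * f' + f (rho p) (zed p).
  by rewrite deriveM//= derive_id /GRing.scale /= -/f' mulr1.
(* The undifferentiated term [f] of the product rule contributes exactly |grad log rho|, so the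
   difference is a positive multiple of [f']. *)
rewrite -[RHS]subr_le0.
have -> : ((x p / y p) ^+ 2 * (rho p / y p))^-1 *
    (rho p * f' + f (rho p) (zed p)) - (rho p)^-1 * (y p / x p) =
    y p ^+ 3 / x p ^+ 2 * f'.
  by rewrite /f -/(x p) -/(y p); field; rewrite x_neq0 y_neq0 gt_eqF.
by rewrite pmulr_rle0// divr_gt0 ?exprn_gt0 ?expR_gt0.
Qed.

End CylindricalMetric.

Theorem propositionA1 (R : realType) (g : 'rV[R]_3 -> 'M[R]_3)
    (alpha u A B : R -> R -> R)
    (g_axi : axisymmetric_metric g alpha u A B)
    (g_flat : asymptotically_flat g) :
  let gc := cyl_metric alpha u A B in
  radial_equation gc rho /\ (radially_monotone gc <-> sub_imcf gc rho).
Proof.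
have [_ [alphaS uS _ _] _] := g_axi.
split; first exact: radial_equation_rho.
exact: radially_monotone_sub_imcf.
Qed.
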